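(* Let $X$ be a compact metrizable space, $S$ a continuous $\mathbb Z^d$-action on $X$, and $n\ge1$. If $\mathcal W\in\mathcal M_n(X,S)\cap\mathcal M_n^\circ$ is ergodic, then $\mathcal W$ is diagonalizable with ergodic eigenmeasures; that is, there is an invertible $\mathbf Q\in\mathbf M_n(\mathbb C)$ such that $\mathbf Q\mathcal W\mathbf Q^{-1}$ is a diagonal matrix of measures, and each measure on its diagonal is ergodic for $S$.
   Context: A measure on $X$ means a complex Borel measure of finite total variation. $\mathbf M_n(\mathbb C)$ is the space of $n\times n$ complex matrices. $\mathcal M_n(X)$ is the set of $n\times n$ matrices $\mathcal W=(\omega_{ij})$ of measures on $X$, viewed as $\mathbf M_n(\mathbb C)$-valued measures; its total variation measure is $|\mathcal W|=\sum_{i,j}|\omega_{ij}|$, and $\int f\,d\mathcal W=(\int f\,d\omega_{ij})_{i,j}$. $\mathcal M_n^\circ$ is the set of nondegenerate $\mathcal W\in\mathcal M_n(X)$, i.e. those for which there is a Borel set $A\subset X$ with $\mathcal W(A)$ invertible. $\mathcal M_n(X,S)$ is the set of $\mathcal W\in\mathcal M_n(X)$ all of whose entries are $S$-invariant measures. $\mathcal W\in\mathcal M_n(X,S)$ is ergodic if for all $f,g\in L^2(|\mathcal W|)$, as $m\to\infty$, $$\frac1{m^d}\sum_{\mathbf k\in[\mathbf 0,m\mathbf 1]}\int_X f\circ S^{-\mathbf k}\cdot g\,d\mathcal W\longrightarrow\Big(\int_X f\,d\mathcal W\Big)\Big(\int_X g\,d\mathcal W\Big),$$ where $[\mathbf 0,m\mathbf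 1]=\{\mathbf k\in\mathbb Z^d:0\le k_i\le m\}$. Ergodicity of a single (scalar) invariant measure is the case $n=1$ of this definition. *)

(* Defs.v *)
From HB Require Import structures.
From mathcomp Require Import all_boot all_order all_algebra.
From mathcomp Require Import all_classical all_reals all_analysis.
From mathcomp Require Import complex lra.

Set Implicit Arguments.
Unset Strict Implicit.
Unset Printing Implicit Defensive.

Import Order.TTheory GRing.Theory Num.Theory.
Import numFieldNormedType.Exports.

Local Open Scope classical_set_scope.
Local Open Scope ring_scope.

Section complex_scalars.
Context {R : realType}.

(* R-valued modulus; `|z| itself lies in R[i]. *)
Definition cabs (z : R[i]) : R := complex.Re `|z|.

Lemma cabsE (z : R[i]) : (cabs z)%:C%C = `|z|.
Proof. reflexivity. Qed.

Lemma cabs_ge0 (z : R[i]) : 0 <= cabs z.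
Proof. by rewrite -lecR cabsE; apply: (@normr_ge0 R[i] R[i]). Qed.

Lemma cabs0 : cabs 0 = 0.
Proof. by rewrite /cabs normr0. Qed.

Lemma ler_cabsD (z w : R[i]) : cabs (z + w) <= cabs z + cabs w.
Proof. by rewrite -lecR rmorphD/= !cabsE; exact: (@ler_normD R[i] R[i]). Qed.

Lemma ler_cabs_sum (I : Type) (r : seq I) (F : I -> R[i]) :
  cabs (\sum_(i <- r) F i) <= \sum_(i <- r) cabs (F i).
Proof.
elim/big_ind2 : _ => [|x a y b ax by_|//]; first by rewrite cabs0.
exact: le_trans (ler_cabsD _ _) (lerD ax by_).
Qed.

Lemma ler_cabs_ReIm (z : R[i]) :
  cabs z <= `|complex.Re z| + `|complex.Im z|.
Proof.
case: z => a b; rewrite /cabs normc_def/= -[leRHS]ger0_norm ?addr_ge0//.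
rewrite -sqrtr_sqr ler_sqrt ?sqr_ge0// sqrrD !real_normK ?num_real//.
by rewrite lerD2r lerDl mulrn_wge0// mulr_ge0.
Qed.

Lemma cabs_ge_Re (z : R[i]) : `|complex.Re z| <= cabs z.
Proof. by have := normc_ge_Re z; rewrite -cabsE lecR. Qed.

Lemma cabs_ge_Im (z : R[i]) : `|complex.Im z| <= cabs z.
Proof.
by case: z => a b; rewrite /cabs normc_def/= -sqrtr_sqr ler_wsqrtr// lerDr sqr_ge0.
Qed.

Lemma cvg_cabs_ball (h : R[i] -> R) (u : nat -> R[i]^o) (l : R[i]^o) :
  (forall z w, `|h z - h w| <= cabs (z - w)) ->
  u @ \oo --> l -> h (u m) @[m --> \oo] --> h l.
Proof.
move=> hcabs /cvgrPdist_lt ul; apply/cvgrPdist_lt => e e0.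
have e0C : 0 < e%:C%C :> R[i] by rewrite ltcR.
near=> m; have : `|l - u m| < e%:C%C by near: m; exact: ul.
by rewrite -cabsE ltcR; apply: le_lt_trans.
Unshelve. all: by end_near. Qed.

Lemma cvg_Re (u : nat -> R[i]^o) (l : R[i]^o) :
  u @ \oo --> l -> complex.Re (u m) @[m --> \oo] --> complex.Re l.
Proof.
apply: (cvg_cabs_ball (h := @complex.Re R)) => z w.
by apply: le_trans (cabs_ge_Re (z - w)); case: z w => [a b] [a' b'].
Qed.

Lemma cvg_Im (u : nat -> R[i]^o) (l : R[i]^o) :
  u @ \oo --> l -> complex.Im (u m) @[m --> \oo] --> complex.Im l.
Proof.
apply: (cvg_cabs_ball (h := @complex.Im R)) => z w.
by apply: le_trans (cabs_ge_Im (z - w)); case: z w => [a b] [a' b'].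
Qed.

Lemma cvg_cabs (u : nat -> R[i]^o) (l : R[i]^o) :
  u @ \oo --> l -> cabs (u m) @[m --> \oo] --> cabs l.
Proof.
apply: cvg_cabs_ball => z w.
have D x y : cabs x <= cabs (x - y) + cabs y by rewrite -{1}(subrK y x) ler_cabsD.
have e : cabs (w - z) = cabs (z - w) by rewrite /cabs distrC.
by have := D z w; have := D w z; rewrite e ler_distl => *; apply/andP; split; lra.
Qed.

End complex_scalars.

Section complex_measure.
Context {d} {T : measurableType d} {R : realType}.

Definition csigma_additive (w : set T -> R[i]) :=
  forall F : nat -> set T, (forall k, measurable (F k)) -> trivIset setT F ->
    (\sum_(0 <= k < m) w (F k) : R[i]^o) @[m --> \oo]
      --> (w (\bigcup_k F k) : R[i]^o).

(* Values on non-measurable sets are irrelevant, as for {charge set T -> \bar R}.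
   Finiteness of the total variation is automatic: see tvar_fin below. *)
Record cmeasure := CMeasure {
  cmeas :> set T -> R[i] ;
  cmeas_sigma_additive : csigma_additive cmeas }.

Definition cRe (w : set T -> R[i]) (A : set T) : \bar R := (complex.Re (w A))%:E.
Definition cIm (w : set T -> R[i]) (A : set T) : \bar R := (complex.Im (w A))%:E.

Lemma csigma_additive0 (w : set T -> R[i]) : csigma_additive w -> w set0 = 0.
Proof.
move=> /(_ (fun=> set0) (fun=> measurable0) (@trivIset_set0 nat T setT)).
rewrite bigcup_const// => w0.
have /cvg_lim : (cst (w set0) : nat -> R[i]^o) @ \oo --> (0 : R[i]^o).
  by apply: cvg_series_cvg_0; apply/cvg_ex; exists (w set0).
by rewrite lim_cst; [apply; exact: norm_hausdorff|exact: norm_hausdorff].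
Qed.

Let cRe0 (w : cmeasure) : cRe w set0 = 0%E.
Proof. by rewrite /cRe (csigma_additive0 (@cmeas_sigma_additive w)). Qed.

Let cIm0 (w : cmeasure) : cIm w set0 = 0%E.
Proof. by rewrite /cIm (csigma_additive0 (@cmeas_sigma_additive w)). Qed.

Let cRe_sigma (w : cmeasure) : semi_sigma_additive (cRe w).
Proof.
move=> F mF tF _; apply/cvg_EFin; first by near=> m; rewrite sumEFin.
rewrite /comp/=; under eq_fun do rewrite sumEFin/=.
have /cvg_Re := @cmeas_sigma_additive w F mF tF.
by under eq_fun => m do rewrite (raddf_sum (@complex.Re R : Rcomplex R -> R)).
Unshelve. all: by end_near. Qed.

Let cIm_sigma (w : cmeasure) : semi_sigma_additive (cIm w).
Proof.
move=> F mF tF _; apply/cvg_EFin; first by near=> m; rewrite sumEFin.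
rewrite /comp/=; under eq_fun do rewrite sumEFin/=.
have /cvg_Im := @cmeas_sigma_additive w F mF tF.
by under eq_fun => m do rewrite (raddf_sum (@complex.Im R : Rcomplex R -> R)).
Unshelve. all: by end_near. Qed.

HB.instance Definition _ (w : cmeasure) := isCharge.Build _ _ _ (cRe w)
  (cRe0 w) (fun _ _ => isT) (@cRe_sigma w).
HB.instance Definition _ (w : cmeasure) := isCharge.Build _ _ _ (cIm w)
  (cIm0 w) (fun _ _ => isT) (@cIm_sigma w).



(* Disjoint families inside A instead of partitions of A: the supremum is the
   same on measurable sets, and it is nonnegative on all sets. *)
Definition tvar (w : set T -> R[i]) (A : set T) : \bar R :=
  ereal_sup [set x | exists m (F : 'I_m -> set T),
    [/\ forall k, measurable (F k), trivIset setT F, forall k, F k `<=` A &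
        x = (\sum_(k < m) cabs (w (F k)))%:E]].

Lemma le_tvar (w : set T -> R[i]) A m (F : 'I_m -> set T) :
  (forall k, measurable (F k)) -> trivIset setT F -> (forall k, F k `<=` A) ->
  ((\sum_(k < m) cabs (w (F k)))%:E <= tvar w A)%E.
Proof. by move=> mF tF FA; apply: ereal_sup_ubound; exists m, F. Qed.

Lemma tvar_ge0 (w : set T -> R[i]) A : (0 <= tvar w A)%E.
Proof.
have := @le_tvar w A 0 (fun=> set0); rewrite big_ord0; apply => [k|i|[]//].
  exact: measurable0.
by case: i.
Qed.

Lemma tvar_set0 (w : cmeasure) : tvar w set0 = 0%E.
Proof.
apply/eqP; rewrite eq_le tvar_ge0 andbT; apply: ge_ereal_sup => _ [m [F [_ _ F0 ->]]].
rewrite big1// => k _; rewrite (_ : F k = set0); last by apply/seteqP; split=> // x /F0.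
by rewrite (csigma_additive0 (@cmeas_sigma_additive w)) cabs0.
Qed.

Lemma le_tvar_set (w : set T -> R[i]) A B : A `<=` B -> (tvar w A <= tvar w B)%E.
Proof.
move=> AB; apply: ereal_sup_le => _ [m [F [mF tF FA ->]]].
by exists m, F; split=> // k x /FA/AB.
Qed.

Lemma le_tvarU (w : set T -> R[i]) A B : A `&` B = set0 ->
  (tvar w A + tvar w B <= tvar w (A `|` B))%E.
Proof.
move=> AB0; have [->|Ufin] := eqVneq (tvar w (A `|` B)) +oo%E; first exact: leey.
have Bfin : tvar w B \is a fin_num.
  rewrite ge0_fin_numE ?tvar_ge0//.
  by rewrite (le_lt_trans (le_tvar_set w (@subsetUr _ A B)))// ltey.
rewrite -leeBrDr//; apply: ge_ereal_sup => _ [m [F [mF tF FA ->]]].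
rewrite leeBrDr// addeC -leeBrDr//; apply: ge_ereal_sup => _ [p [G [mG tG GB ->]]].
rewrite leeBrDr// addeC -EFinD.
pose H (k : 'I_(m + p)) := match fintype.split k with inl a => F a | inr b => G b end.
have HF a : H (lshift p a) = F a by rewrite /H (unsplitK (inl a)).
have HG b : H (rshift m b) = G b by rewrite /H (unsplitK (inr b)).
have AB x : A x -> B x -> False.
  by move=> Ax Bx; have : (A `&` B) x by []; rewrite AB0.
have := @le_tvar w (A `|` B) _ H; rewrite big_split_ord/=.
under eq_bigr do rewrite HF.
under [X in (_ + X)%R]eq_bigr do rewrite HG.
apply.
- by move=> k; case: (split_ordP k) => a ->; rewrite ?HF ?HG.
- move=> k l _ _; case: (split_ordP k) => a ->; case: (split_ordP l) => b ->;
    rewrite ?HF ?HG.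
  + by move=> /tF ->.
  + by move=> [x [/FA Ax /GB Bx]]; case: (AB x).
  + by move=> [x [/GB Bx /FA Ax]]; case: (AB x).
  + by move=> /tG ->.
- move=> k; case: (split_ordP k) => a ->; rewrite ?HF ?HG => x.
  + by move=> /FA; left.
  + by move=> /GB; right.
Qed.

Let cabs_series (w : cmeasure) (E : nat -> set T) A :
  (forall j, measurable (E j)) -> trivIset setT E -> measurable A ->
  A `<=` \bigcup_j E j ->
  ((cabs (w A))%:E <= \sum_(0 <= j <oo) (cabs (w (A `&` E j)))%:E)%E.
Proof.
move=> mE tE mA AE.
have := @cmeas_sigma_additive w (fun j => A `&` E j)
  (fun j => measurableI _ _ mA (mE j)) (@trivIset_setIl T nat setT E (fun=> A) tE).
rewrite -setI_bigcupr (setIidl AE) => /cvg_cabs wA.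
have wA' : (cabs (\sum_(0 <= j < m) w (A `&` E j)))%:E @[m --> \oo] --> (cabs (w A))%:E.
  by apply: cvg_EFin wA; exact: nearW.
rewrite -(cvg_lim _ wA')//; apply: lime_le; first by apply/cvg_ex; eexists; exact: wA'.
apply: nearW => m.
apply: (@le_trans _ _ (\sum_(0 <= j < m) (cabs (w (A `&` E j)))%:E)%E).
  by rewrite sumEFin lee_fin ler_cabs_sum.
by apply: nneseries_lim_ge => j _ _; rewrite lee_fin cabs_ge0.
Qed.

Let tvar_sigma (w : cmeasure) : semi_sigma_additive (tvar w).
Proof.
move=> E mE tE _.
suff <- : (\sum_(0 <= j <oo) tvar w (E j) = tvar w (\bigcup_j E j))%E.
  by apply: is_cvg_nneseries => j _ _; exact: tvar_ge0.
apply/eqP; rewrite eq_le; apply/andP; split.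
  apply: lime_le; first by apply: is_cvg_nneseries => j _ _; exact: tvar_ge0.
  apply: nearW => m.
  apply: (@le_trans _ _ (tvar w (\bigcup_(j in `I_m) E j))); last first.
    by apply: le_tvar_set; exact: bigcup_subset.
  elim: m => [|m ih]; first by rewrite big_geq// tvar_ge0.
  rewrite big_nat_recr//= (le_trans (leeD2r _ ih))// IIS bigcup_setU bigcup_set1.
  apply: le_tvarU; rewrite setI_bigcupl; apply: bigcup0 => j /= jm.
  by move/trivIsetP : tE; apply => //; rewrite ltn_eqF.
apply: ge_ereal_sup => _ [m [F [mF tF FE ->]]]; rewrite -sumEFin.
apply: (@le_trans _ _
    (\sum_(k < m) \sum_(0 <= j <oo) (cabs (w (F k `&` E j)))%:E)%E).
  by apply: lee_sum => k _; exact: cabs_series.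
rewrite -nneseries_sum; last by move=> k j _; rewrite lee_fin cabs_ge0.
apply: lee_nneseries => j _.
  by move=> _; apply: sume_ge0 => k _; rewrite lee_fin cabs_ge0.
rewrite sumEFin; apply: le_tvar => [k||k].
- exact: measurableI.
- exact: trivIset_setIr.
- exact: subIsetr.
Qed.

HB.instance Definition _ (w : cmeasure) := isMeasure.Build _ _ _ (tvar w)
  (tvar_set0 w) (@tvar_ge0 w) (@tvar_sigma w).

Lemma tvar_fin (w : cmeasure) : (tvar w setT < +oo)%E.
Proof.
have [P [N PN]] := Hahn_decomposition (cRe w).
have [P' [N' PN']] := Hahn_decomposition (cIm w).
have VT (nu : {charge set T -> \bar R}) P1 N1 (h : hahn_decomposition nu P1 N1) m
    (F : 'I_m -> set T) : (forall k, measurable (F k)) -> trivIset setT F ->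
    (\sum_(k < m) `|nu (F k)| <= charge_variation h setT)%E.
  move=> mF tF.
  apply: (@le_trans _ _ (\sum_(k < m) charge_variation h (F k))%E).
    by apply: lee_sum => k _; exact: abse_charge_variation.
  rewrite -(measure_bigsetU_ord (charge_variation h) xpredT mF tF).
  by apply: le_measure => //; rewrite inE//; exact: bigsetU_measurable.
apply: (@le_lt_trans _ _ (charge_variation PN setT + charge_variation PN' setT)%E).
  apply: ge_ereal_sup => _ [m [F [mF tF _ ->]]].
  have /leeD/(_ (VT _ _ _ PN' m F mF tF)) := VT _ _ _ PN m F mF tF.
  apply: le_trans; rewrite -big_split/= -sumEFin; apply: lee_sum => k _.
  by rewrite -EFinD lee_fin ler_cabs_ReIm.
by rewrite ltey_eq fin_numD !fin_num_measure.
Qed.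

End complex_measure.
Arguments cmeasure {d} T R.

Section integration.
Context {d} {T : measurableType d} {R : realType}.

Let hahn (nu : {charge set T -> \bar R}) :
  exists PN : set T * set T, hahn_decomposition nu PN.1 PN.2.
Proof. by have [P [N h]] := Hahn_decomposition nu; exists (P, N). Qed.

(* Integral against a signed measure through its Jordan decomposition, which does
   not depend on the chosen Hahn decomposition. *)
Definition charge_integral (nu : {charge set T -> \bar R}) (f : T -> R) : R :=
  let PN := svalP (cid (hahn nu)) in
  \int[jordan_pos PN]_x f x - \int[jordan_neg PN]_x f x.

Definition cintegral (w : cmeasure T R) (f : T -> R[i]) : R[i] :=
  let u x := complex.Re (f x) in
  let v x := complex.Im (f x) in
  Complex (charge_integral (cRe w) u - charge_integral (cIm w) v)
          (charge_integral (cRe w) v + charge_integral (cIm w) u).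

Definition L2 (mu : {measure set T -> \bar R}) (f : T -> R[i]) :=
  [/\ measurable_fun setT (fun x => complex.Re (f x)),
      measurable_fun setT (fun x => complex.Im (f x)) &
      (\int[mu]_x (cabs (f x) ^+ 2)%:E < +oo)%E].

End integration.

Section matrix_measure.
Context {d} {T : measurableType d} {R : realType} {n : nat}.
Implicit Types W : 'M[cmeasure T R]_n.

Definition mxmeas W (A : set T) : 'M[R[i]]_n := \matrix_(i, j) W i j A.

Definition mxtvar W (A : set T) : \bar R := (\sum_i \sum_j tvar (W i j) A)%E.

Let mxtvar0 W : mxtvar W set0 = 0%E.
Proof. by rewrite /mxtvar big1// => i _; rewrite big1// => j _; rewrite tvar_set0. Qed.

Let mxtvar_ge0 W A : (0 <= mxtvar W A)%E.
Proof. by apply: sume_ge0 => i _; apply: sume_ge0 => j _; exact: tvar_ge0. Qed.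

Let mxtvar_sigma W : semi_sigma_additive (mxtvar W).
Proof.
move=> F mF tF mUF; under eq_fun do rewrite exchange_big/=.
apply: cvg_nnesum => i _.
  by apply: nearW => m; apply: sume_ge0 => k _; apply: sume_ge0 => j _; exact: tvar_ge0.
under eq_fun do rewrite exchange_big/=.
apply: cvg_nnesum => j _.
  by apply: nearW => m; apply: sume_ge0 => k _; exact: tvar_ge0.
exact: (@measure_semi_sigma_additive _ _ _ (tvar (W i j))).
Qed.

HB.instance Definition _ W := isMeasure.Build _ _ _ (mxtvar W)
  (mxtvar0 W) (@mxtvar_ge0 W) (@mxtvar_sigma W).

Definition mxintegral W (f : T -> R[i]) : 'M[R[i]]_n :=
  \matrix_(i, j) cintegral (W i j) f.

Definition mxnondegenerate W :=
  exists2 A : set T, measurable A & mxmeas W A \in unitmx.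

Lemma csigma_additive_sum (a : 'I_n -> R[i]) (w : 'I_n -> set T -> R[i]) :
  (forall k, csigma_additive (w k)) ->
  csigma_additive (fun A => \sum_k a k * w k A).
Proof.
move=> ws F mF tF; under eq_fun do rewrite exchange_big/=.
apply: (@cvg_big (R[i]^o)) => [|k _]; first exact: add_continuous.
under eq_fun do rewrite -mulr_sumr.
by apply: cvgM; [exact: cvg_cst|exact: ws].
Qed.

Lemma mxconj_sigma_additive (Q : 'M[R[i]]_n) W i j :
  csigma_additive (fun A => (Q *m mxmeas W A *m invmx Q) i j).
Proof.
have -> : (fun A => (Q *m mxmeas W A *m invmx Q) i j) =
    (fun A => \sum_l invmx Q l j * \sum_k Q i k * W k l A).
  apply/funext => A; rewrite mxE; apply: eq_bigr => l _; rewrite mulrC mxE.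
  by congr (_ * _); apply: eq_bigr => k _; rewrite mxE.
apply: csigma_additive_sum => l; apply: csigma_additive_sum => k.
exact: cmeas_sigma_additive.
Qed.

Definition mxconj (Q : 'M[R[i]]_n) W : 'M[cmeasure T R]_n :=
  \matrix_(i, j) CMeasure (@mxconj_sigma_additive Q W i j).

Lemma mxmeas_mxconj (Q : 'M[R[i]]_n) W A :
  mxmeas (mxconj Q W) A = Q *m mxmeas W A *m invmx Q.
Proof. by apply/matrixP => i j; rewrite [LHS]mxE [mxconj _ _ _ _]mxE. Qed.

Definition diagonal_mxmeas W :=
  forall i j, i != j -> forall A, measurable A -> W i j A = 0.

End matrix_measure.

Section ergodicity.
Context {d} {T : measurableType d} {R : realType} {r : nat}.
Implicit Types S : 'rV[int]_r -> T -> T.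

Definition invariant_measure (w : cmeasure T R) S :=
  forall k A, measurable A -> w (S k @^-1` A) = w A.

Definition mxinvariant n (W : 'M[cmeasure T R]_n) S :=
  forall i j, invariant_measure (W i j) S.

Definition box_point m (k : 'rV['I_m.+1]_r) : 'rV[int]_r :=
  map_mx (fun j : 'I_m.+1 => (j : nat)%:Z) k.

Definition ergodic_mean n (W : 'M[cmeasure T R]_n) S (f g : T -> R[i]) (m : nat) :
    'M[R[i]]_n :=
  ((m ^ r)%:R^-1 : R[i]) *:
    \sum_(k : 'rV['I_m.+1]_r) mxintegral W (fun x => f (S (- box_point k) x) * g x).

(* R[i]^o carries the norm topology of C, and 'M[R[i]^o]_n its entrywise one. *)
Definition mxergodic n (W : 'M[cmeasure T R]_n) S :=
  mxinvariant W S /\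
  forall f g, L2 (mxtvar W) f -> L2 (mxtvar W) g ->
    (ergodic_mean W S f g m : 'M[R[i]^o]_n) @[m --> \oo] -->
      (mxintegral W f *m mxintegral W g : 'M[R[i]^o]_n).

Definition ergodic_measure (w : cmeasure T R) S :=
  mxergodic (const_mx w : 'M[cmeasure T R]_1) S.

End ergodicity.

Section topological_dynamics.

Definition metrizable (R : realType) (X : topologicalType) :=
  exists dist : X -> X -> R,
    [/\ forall x y, dist x y = 0 <-> x = y,
        forall x y, dist x y = dist y x,
        forall x y z, dist x z <= dist x y + dist y z &
        forall x A, nbhs x A <-> exists2 e, 0 < e & [set y | dist x y < e] `<=` A].

(* The library's measurable types are pointed, hence ptopologicalType. Only the
   empty space is lost, and it carries no nondegenerate matrix measure of size
   n >= 1. *)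
Definition borelType (X : ptopologicalType) := g_sigma_algebraType (@open X).

Definition continuous_Zd_action r (X : topologicalType) (S : 'rV[int]_r -> X -> X) :=
  [/\ forall x, S 0 x = x,
      forall k l x, S (k + l) x = S k (S l x) &
      forall k, continuous (S k)].

End topological_dynamics.

(* Main.v *)
(* Indicator functions turn ergodicity into W(A & B) = W(A) W(B) for A strictly
   invariant and B measurable, and nondegeneracy then gives W(X) = 1. Hence the
   matrices W(A), A invariant, are commuting idempotents, and induction on their
   rank splits X into finitely many invariant sets C that cannot be split further
   up to W-null sets. On such a C the invariant measure W is a real-valued
   measure times the matrix W(C), by an invariant Hahn decomposition. A common
   eigenbasis of the W(C) therefore diagonalizes W; each eigenmeasure is one of
   these real-valued measures, and it inherits ergodicity from W. *)

Require Import Defs.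
From mathcomp Require Import all_boot all_order all_algebra.
From mathcomp Require Import all_classical all_reals all_analysis.
From mathcomp Require Import complex measurable_realfun lra.

Local Open Scope classical_set_scope.
Local Open Scope ring_scope.

Set Implicit Arguments.
Unset Strict Implicit.
Unset Printing Implicit Defensive.

Import Order.TTheory GRing.Theory Num.Theory.
Import numFieldNormedType.Exports.

(** * Integrals against dominated measures and signed measures *)

Section dominated_measures.
Context {d} {T : measurableType d} {R : realType}.
Local Open Scope ereal_scope.

Lemma ge0_integral_le_mscale (mu1 mu2 : {measure set T -> \bar R}) (c : {nonneg R})
    (f : T -> \bar R) :
  (forall B, measurable B -> mu1 B <= c%:num%:E * mu2 B) ->
  (forall x, 0 <= f x) -> measurable_fun setT f ->
  \int[mu1]_x f x <= c%:num%:E * \int[mu2]_x f x.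
Proof.
move=> mu12 f0 mf; rewrite -ge0_integral_mscale//.
exact: ge0_le_measure_integral.
Qed.

Lemma integrable_le_mscale (mu1 mu2 : {measure set T -> \bar R}) (c : {nonneg R})
    (f : T -> \bar R) :
  (forall B, measurable B -> mu1 B <= c%:num%:E * mu2 B) ->
  mu2.-integrable setT f -> mu1.-integrable setT f.
Proof.
move=> mu12 /integrableP[mf foo]; apply/integrableP; split=> //.
apply: le_lt_trans (ge0_integral_le_mscale mu12 _ _) _ => //.
  exact: measurableT_comp.
by rewrite lte_mul_pinfty// lee_fin.
Qed.

Lemma integral_mscale (mu : {measure set T -> \bar R}) (c : {nonneg R})
    (f : T -> \bar R) :
  mu.-integrable setT f ->
  \int[mscale c mu]_x f x = c%:num%:E * \int[mu]_x f x.
Proof.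
move=> intf; have mf := measurable_int _ intf.
rewrite [LHS]integralE [X in _ = _ * X]integralE.
rewrite !ge0_integral_mscale//; [|exact: measurable_funeneg|exact: measurable_funepos].
rewrite [RHS]muleBr//; apply: fin_num_adde_defl; rewrite fin_numN.
by apply: integrable_fin_num => //; exact: integrable_funeneg.
Qed.

(** With the negative terms moved across, both sides of the hypothesis are positive measures, so
    additivity of the integral applies. This compares signed measures without matching their Jordan
    parts. *)
Lemma Rintegral_measureB_mscale (p1 n1 p2 n2 : {measure set T -> \bar R})
    (c : {nonneg R}) (h : T -> R) :
  (forall B, measurable B ->
    p1 B + c%:num%:E * n2 B = n1 B + c%:num%:E * p2 B) ->
  p1.-integrable setT (EFin \o h) -> n1.-integrable setT (EFin \o h) ->
  p2.-integrable setT (EFin \o h) -> n2.-integrable setT (EFin \o h) ->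
  (\int[p1]_x h x - \int[n1]_x h x =
    c%:num * (\int[p2]_x h x - \int[n2]_x h x))%R.
Proof.
move=> pn ip1 in1 ip2 in2.
have is2 (mu : {measure set T -> \bar R}) : mu.-integrable setT (EFin \o h) ->
    (mscale c mu).-integrable setT (EFin \o h).
  by apply: integrable_le_mscale => B _; exact: lexx.
have : \int[measure_add p1 (mscale c n2)]_x (h x)%:E =
       \int[measure_add n1 (mscale c p2)]_x (h x)%:E.
  apply: eq_measure_integral => B mB _.
  by rewrite [LHS]measure_addE [RHS]measure_addE; exact: pn.
rewrite !integral_measure_add//; [|exact: is2|exact: is2].
rewrite !integral_mscale//.
move: (integrable_fin_num measurableT ip1) (integrable_fin_num measurableT in1)
  (integrable_fin_num measurableT ip2) (integrable_fin_num measurableT in2).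
rewrite /Rintegral /comp/=.
case: (integral p1 _ _) (integral n1 _ _) (integral p2 _ _) (integral n2 _ _) =>
  [x| |] [y| |] [z| |] [t| |]// _ _ _ _ [e] /=.
by rewrite mulrBr; apply/eqP; rewrite subr_eq addrAC -subr_eq opprK e addrC.
Qed.

Lemma Rintegral_restr (mu muA : {measure set T -> \bar R}) A (h : T -> R) :
  measurable A -> (forall B, measurable B -> muA B = mu (B `&` A)) ->
  muA.-integrable setT (EFin \o h) ->
  (\int[mu]_x (\1_A x * h x) = \int[muA]_x h x)%R.
Proof.
move=> mA muAE ih; rewrite /Rintegral; congr fine.
rewrite [RHS](@negligible_integral _ _ _ _ _ (~` A))//; last first.
- by rewrite muAE ?setICl ?measure0//; exact: measurableC.
- exact: measurableC.
rewrite setTD setCK; transitivity (\int[mu]_(x in A) (h x)%:E); last first.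
  by apply: eq_measure_integral => B mB BA; rewrite muAE// setIidl.
rewrite [RHS]integral_mkcond; apply: eq_integral => x _.
by rewrite patchE indicE; case: ifPn => xA; rewrite ?mul1r ?mul0r.
Qed.

Lemma fin_num_eqBM (x y z t : \bar R) (a : R) :
  x \is a fin_num -> y \is a fin_num -> z \is a fin_num -> t \is a fin_num ->
  x - y = a%:E * (z - t) -> x + a%:E * t = y + a%:E * z.
Proof.
case: x y z t => [x| |] [y| |] [z| |] [t| |]// _ _ _ _ [e].
by congr EFin; lra.
Qed.

(* Hides the choice of a Hahn decomposition made in [charge_integral]. *)
Lemma charge_integral_jordan (nu : {charge set T -> \bar R}) :
  exists P N (p n : {measure set T -> \bar R}),
  [/\ measurable P /\ measurable N,
      forall B, measurable B -> p B = nu (B `&` P),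
      forall B, measurable B -> n B = - nu (B `&` N),
      forall B, measurable B -> nu B = p B - n B &
      forall f, charge_integral nu f = (\int[p]_x f x - \int[n]_x f x)%R].
Proof.
have [P [N [PN e]]] : exists P N (PN : hahn_decomposition nu P N), forall f,
    charge_integral nu f = (\int[jordan_pos PN]_x f x - \int[jordan_neg PN]_x f x)%R.
  by do 3 eexists; move=> f; reflexivity.
exists P, N, (jordan_pos PN), (jordan_neg PN); split=> [|B mB|B mB|B mB|//].
- by have [[mP _] [mN _] _ _] := PN.
- by rewrite [LHS]jordan_posE cjordan_posE /crestr0 mem_set.
- by rewrite [LHS]jordan_negE cjordan_negE /crestr0 mem_set.
- by rewrite [LHS](jordan_decomp PN mB) /cadd/= /cscale/= mulN1e.
Qed.

Lemma charge_integral_indic (nu : {charge set T -> \bar R}) B :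
  measurable B -> (charge_integral nu \1_B)%:E = nu B.
Proof.
move=> mB; have [P [N [p [n [[mP mN] pE nE nuE ->]]]]] := charge_integral_jordan nu.
rewrite /Rintegral !integral_indic// !setIT EFinB !fineK ?nuE//.
  by rewrite nE// fin_numN fin_num_measure//; exact: measurableI.
by rewrite pE// fin_num_measure//; exact: measurableI.
Qed.

(** The Hahn decompositions of [nu1] and [nu2] are chosen independently, so their Jordan parts need
    not correspond on [A]; only the differences do. The measure [M] dominates all four parts up to a
    constant and makes [h] integrable for each. *)
Lemma charge_integral_restr (nu1 nu2 : {charge set T -> \bar R})
    (M : {measure set T -> \bar R}) A (a : R) (h : T -> R) : measurable A ->
  (forall B, measurable B -> nu1 (B `&` A) = a%:E * nu2 B) ->
  (forall B, measurable B -> `|nu2 B| <= M B) ->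
  M.-integrable setT (EFin \o h) ->
  charge_integral nu1 (fun x => \1_A x * h x)%R = (a * charge_integral nu2 h)%R.
Proof.
move=> mA nu12 nu2M ih.
have [P1 [N1 [p1 [n1 [[mP1 mN1] p1E n1E nu1E ->]]]]] := charge_integral_jordan nu1.
have [P2 [N2 [p2 [n2 [[mP2 mN2] p2E n2E nu2E ->]]]]] := charge_integral_jordan nu2.
have nu1M C D : measurable C -> measurable D ->
    `|nu1 (C `&` A `&` D)| <= `|a|%R%:E * M C.
  move=> mC mD; rewrite setIAC nu12; last exact: measurableI.
  rewrite abseM lee_pmul//; apply: le_trans (nu2M _ _) _; first exact: measurableI.
  by apply: le_measure; rewrite ?inE//; exact: measurableI.
have nu2M' C D : measurable C -> measurable D -> `|nu2 (C `&` D)| <= M C.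
  move=> mC mD; apply: le_trans (nu2M _ _) _; first exact: measurableI.
  by apply: le_measure; rewrite ?inE//; exact: measurableI.
have mBA B : measurable B -> measurable (B `&` A) by move=> mB; exact: measurableI.
have [pA pAE] : exists pA : {measure set T -> \bar R},
  forall B, pA B = p1 (B `&` A) by exists (mrestr p1 mA).
have [nA nAE] : exists nA : {measure set T -> \bar R},
  forall B, nA B = n1 (B `&` A) by exists (mrestr n1 mA).
have ip1 : pA.-integrable setT (EFin \o h).
  apply: (@integrable_le_mscale _ M (`|a|%:nng)%R) ih => B mB.
  rewrite pAE p1E; last exact: mBA.
  by rewrite (le_trans _ (nu1M _ _ mB mP1))// lee_abs.
have in1 : nA.-integrable setT (EFin \o h).
  apply: (@integrable_le_mscale _ M (`|a|%:nng)%R) ih => B mB.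
  rewrite nAE n1E; last exact: mBA.
  by rewrite (le_trans _ (nu1M _ _ mB mN1))// -abseN lee_abs.
have ip2 : p2.-integrable setT (EFin \o h).
  apply: (@integrable_le_mscale _ M (1%:nng)%R) ih => B mB.
  by rewrite mul1e p2E// (le_trans _ (nu2M' _ _ mB mP2))// lee_abs.
have in2 : n2.-integrable setT (EFin \o h).
  apply: (@integrable_le_mscale _ M (1%:nng)%R) ih => B mB.
  by rewrite mul1e n2E// (le_trans _ (nu2M' _ _ mB mN2))// -abseN lee_abs.
rewrite (@Rintegral_restr p1 pA)// (@Rintegral_restr n1 nA)//.
have fin B : measurable B -> [/\ pA B \is a fin_num, nA B \is a fin_num,
    p2 B \is a fin_num & n2 B \is a fin_num].
  move=> mB; rewrite pAE nAE p1E ?n1E ?p2E ?n2E//; [|exact: mBA..].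
  by rewrite !fin_numN !fin_num_measure//; do ?apply: measurableI.
have key B : measurable B -> pA B - nA B = a%:E * (p2 B - n2 B).
  by move=> mB; rewrite pAE nAE -nu1E ?nu12 ?nu2E//; exact: mBA.
have [a0|a0] := leP 0%R a.
  apply: (@Rintegral_measureB_mscale pA nA p2 n2 (NngNum a0)) => // B mB.
  by have [? ? ? ?] := fin _ mB; apply: fin_num_eqBM => //; exact: key.
(* A measure can only be scaled by a nonnegative factor, so for negative [a] the parts [p2] and [n2]
   exchange roles. *)
have a0' : (0 <= - a)%R by lra.
rewrite -[in RHS]opprB mulrN -mulNr.
apply: (@Rintegral_measureB_mscale pA nA n2 p2 (NngNum a0')) => // B mB.
have [? ? ? ?] := fin _ mB; apply: fin_num_eqBM => //.
by rewrite key// EFinN mulNe -muleN fin_num_oppeB// addeC.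
Qed.

End dominated_measures.

(** * Total variation and complex integrals *)

Section complex_measures.
Context {d} {T : measurableType d} {R : realType}.
Implicit Types (w : cmeasure T R) (f g h : T -> R[i]).

Lemma cabsM (z w : R[i]) : cabs (z * w) = cabs z * cabs w.
Proof. by apply: (@complexI R); rewrite rmorphM/= !cabsE normrM. Qed.

Lemma cabs_sqr (z : R[i]) : cabs z ^+ 2 = complex.Re z ^+ 2 + complex.Im z ^+ 2.
Proof.
by case: z => a b; rewrite /cabs normc_def/= sqr_sqrtr// addr_ge0// sqr_ge0.
Qed.

Lemma le_cabs_tvar w B : measurable B -> ((cabs (w B))%:E <= tvar w B)%E.
Proof.
move=> mB; have := @le_tvar _ _ _ w B 1 (fun=> B); rewrite big_ord1; apply=> // [|_ x //].
by move=> i j; rewrite !ord1.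
Qed.

Lemma tvar_restr_le w1 w2 A (z : R[i]) B :
  (forall C, measurable C -> w1 (C `&` A) = z * w2 C) ->
  (tvar w1 (B `&` A) <= (cabs z)%:E * tvar w2 B)%E.
Proof.
move=> w12; apply: ge_ereal_sup => _ [m [F [mF tF FB ->]]].
under eq_bigr => k _.
  rewrite -[F k](_ : F k `&` A = _); last by apply: setIidl => x /FB[].
  rewrite w12// cabsM; over.
rewrite -mulr_sumr EFinM lee_wpmul2l ?lee_fin ?cabs_ge0//.
by apply: le_tvar => // k x /FB[].
Qed.

(** Pulling a disjoint family in the preimage of [B] back along [psi] gives a disjoint family in [B]
    with the same values of [w]. *)
Lemma tvar_preimage_le w (phi psi : T -> T) B :
  measurable_fun setT psi -> cancel psi phi ->
  (forall C, measurable C -> w (psi @^-1` C) = w C) ->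
  (tvar w (phi @^-1` B) <= tvar w B)%E.
Proof.
move=> mpsi psiK winv; apply: ge_ereal_sup => _ [m [F [mF tF FB ->]]].
under eq_bigr => k _ do rewrite -winv//.
apply: le_tvar => [k||k x /= /FB /=]; last by rewrite psiK.
- by rewrite -[X in measurable X]setTI; exact: mpsi.
- by move=> k l _ _ [x [Fk Fl]]; apply: tF => //; exists (psi x).
Qed.

Lemma cintegral_indic w B :
  measurable B -> cintegral w (fun x => (\1_B x : R)%:C%C) = w B.
Proof.
move=> mB; have ci0 nu : charge_integral nu (fun x : T => 0 : R) = 0.
  have [P [N [p [n [_ _ _ _ ->]]]]] := charge_integral_jordan nu.
  by rewrite /Rintegral !integral0/= subr0.
rewrite /cintegral/= !ci0 subr0 add0r.
have := charge_integral_indic (cRe w) mB; have := charge_integral_indic (cIm w) mB.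
by rewrite /cRe /cIm => -[->] [->]; case: (w B).
Qed.

(** Since [w2] is real-valued, both parts of [w1] on [A] are real multiples, by Re z and Im z, of
    the single charge [cRe w2]. *)
Lemma cintegral_restr w1 w2 A (z : R[i]) h : measurable A ->
  (forall B, measurable B -> w1 (B `&` A) = z * w2 B) ->
  (forall B, measurable B -> complex.Im (w2 B) = 0) ->
  (tvar w2).-integrable setT (fun x => (complex.Re (h x))%:E) ->
  (tvar w2).-integrable setT (fun x => (complex.Im (h x))%:E) ->
  cintegral w1 (fun x => (\1_A x : R)%:C%C * h x) = z * cintegral w2 h.
Proof.
move=> mA w12 im0 iRe iIm.
have domRe B : measurable B -> (`|cRe w2 B| <= tvar w2 B)%E.
  move=> mB; apply: le_trans (le_cabs_tvar w2 mB).
  by rewrite /cRe lee_fin cabs_ge_Re.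
have scal (nu : {charge set T -> \bar R}) (a : R) (u : T -> R) :
    (forall B, measurable B -> nu (B `&` A) = a%:E * cRe w2 B)%E ->
    (tvar w2).-integrable setT (EFin \o u) ->
    charge_integral nu (fun x => \1_A x * u x) = a * charge_integral (cRe w2) u.
  by move=> nuE iu; exact: charge_integral_restr iu.
have im (u : T -> R) : (tvar w2).-integrable setT (EFin \o u) ->
    charge_integral (cIm w2) u = 0.
  move=> iu; transitivity (charge_integral (cIm w2) (fun x => \1_setT x * u x)).
    by congr charge_integral; apply/funext => x; rewrite indicT mul1r.
  (* On measurable sets [cIm w2] is 0 times [cRe w2], so this is the scaling rule with factor 0. *)
  rewrite (@charge_integral_restr _ _ _ (cIm w2) (cRe w2) (tvar w2) setT 0)//.
    by rewrite mul0r.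
  by move=> B mB; rewrite setIT mul0e; congr EFin; exact: im0.
have w1Re B : measurable B -> (cRe w1 (B `&` A) = (complex.Re z)%:E * cRe w2 B)%E.
  move=> mB; rewrite /cRe w12//; have := im0 B mB.
  by case: (z) (w2 B) => a b [c e] /= ->; rewrite mulr0 subr0 EFinM.
have w1Im B : measurable B -> (cIm w1 (B `&` A) = (complex.Im z)%:E * cRe w2 B)%E.
  move=> mB; rewrite /cIm /cRe w12//; have := im0 B mB.
  by case: (z) (w2 B) => a b [c e] /= ->; rewrite mulr0 add0r EFinM.
rewrite /cintegral (im _ iRe) (im _ iIm) subr0 addr0.
have ReE : (fun x => complex.Re ((\1_A x : R)%:C%C * h x)) =
    (fun x => \1_A x * complex.Re (h x)).
  by apply/funext => x; case: (h x) => a b /=; rewrite mul0r subr0.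
have ImE : (fun x => complex.Im ((\1_A x : R)%:C%C * h x)) =
    (fun x => \1_A x * complex.Im (h x)).
  by apply/funext => x; case: (h x) => a b /=; rewrite mul0r addr0.
rewrite ReE ImE !(scal _ _ _ w1Re)// !(scal _ _ _ w1Im)//.
by case: (z).
Qed.

End complex_measures.

(** * Square-integrable functions *)

Section square_integrable.
Context {d} {T : measurableType d} {R : realType}.
Implicit Types (mu : {measure set T -> \bar R}) (f g : T -> R[i]).

Lemma measurable_cabs_sqr f :
  measurable_fun setT (fun x => complex.Re (f x)) ->
  measurable_fun setT (fun x => complex.Im (f x)) ->
  measurable_fun setT (fun x => cabs (f x) ^+ 2).
Proof.
move=> mRe mIm; under eq_fun do rewrite cabs_sqr.
by apply: measurable_funD; exact: measurable_funX.
Qed.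

(** The pointwise bound |fg| <= |f|^2 + |g|^2 follows from (|f| - |g|)^2 >= 0. *)
Lemma L2_mul_integrable mu f g : L2 mu f -> L2 mu g ->
  mu.-integrable setT (fun x => (complex.Re (f x * g x))%:E) /\
  mu.-integrable setT (fun x => (complex.Im (f x * g x))%:E).
Proof.
move=> [mRf mIf f2] [mRg mIg g2].
have int2 h : measurable_fun setT (fun x => cabs (h x) ^+ 2) ->
    (\int[mu]_x (cabs (h x) ^+ 2)%:E < +oo)%E ->
    mu.-integrable setT (fun x => (cabs (h x) ^+ 2)%:E).
  move=> mh h2; apply/integrableP; split; first exact/measurable_EFinP.
  by under eq_integral do rewrite gee0_abs ?lee_fin ?sqr_ge0//.
have ifg : mu.-integrable setT
    (fun x => (cabs (f x) ^+ 2)%:E + (cabs (g x) ^+ 2)%:E)%E.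
  by apply: integrableD => //; apply: int2 => //; exact: measurable_cabs_sqr.
have bound (u : T -> R) : (forall x, `|u x| <= cabs (f x * g x)) ->
    forall x, setT x ->
    (`|(u x)%:E| <= `|(cabs (f x) ^+ 2)%:E + (cabs (g x) ^+ 2)%:E|)%E.
  move=> ub x _; rewrite -EFinD !abse_EFin lee_fin.
  rewrite [leRHS]ger0_norm ?addr_ge0 ?sqr_ge0//; apply: le_trans (ub x) _.
  rewrite cabsM; have := sqr_ge0 (cabs (f x) - cabs (g x)).
  by have := cabs_ge0 (f x); have := cabs_ge0 (g x); nra.
split; apply: le_integrable (bound _ _) ifg => //.
- apply/measurable_EFinP.
  rewrite (_ : (fun x => _) = fun x => complex.Re (f x) * complex.Re (g x)
     - complex.Im (f x) * complex.Im (g x)); last first.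
    by apply/funext => x; case: (f x) (g x) => a b [].
  by apply: measurable_funB; exact: measurable_funM.
- by move=> x; exact: cabs_ge_Re.
- apply/measurable_EFinP.
  rewrite (_ : (fun x => _) = fun x => complex.Re (f x) * complex.Im (g x)
     + complex.Im (f x) * complex.Re (g x)); last first.
    by apply/funext => x; case: (f x) (g x) => a b [].
  by apply: measurable_funD; exact: measurable_funM.
- by move=> x; exact: cabs_ge_Im.
Qed.

Lemma L2_indic mu B : measurable B -> (mu setT < +oo)%E ->
  L2 mu (fun x => (\1_B x : R)%:C%C).
Proof.
move=> mB mufin; split=> /=; first exact: measurable_indic.
  exact: measurable_cst.
under eq_integral => x _.
  rewrite cabs_sqr/= expr0n/= addr0 (_ : \1_B x ^+ 2 = \1_B x); first over.
  by rewrite indicE; case: (x \in B); rewrite ?expr1n ?expr0n.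
rewrite integral_indic// setIT; apply: le_lt_trans mufin.
by apply: le_measure; rewrite ?inE.
Qed.

(** Cutting off outside [A] turns test functions for a component into test functions for the whole
    matrix measure. *)
Lemma L2_restr mu1 mu2 A (c : R) f : measurable A -> 0 <= c ->
  (forall B, measurable B -> (mu1 (B `&` A) <= c%:E * mu2 B)%E) ->
  L2 mu2 f -> L2 mu1 (fun x => (\1_A x : R)%:C%C * f x).
Proof.
move=> mA c0 mu12 [mRe mIm f2].
have mR : measurable_fun setT (fun x => complex.Re ((\1_A x : R)%:C%C * f x)).
  rewrite (_ : (fun x => _) = fun x => \1_A x * complex.Re (f x)).
    by apply: measurable_funM => //; exact: measurable_indic.
  by apply/funext => x; case: (f x) => a b /=; rewrite mul0r subr0.
have mI : measurable_fun setT (fun x => complex.Im ((\1_A x : R)%:C%C * f x)).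
  rewrite (_ : (fun x => _) = fun x => \1_A x * complex.Im (f x)).
    by apply: measurable_funM => //; exact: measurable_indic.
  by apply/funext => x; case: (f x) => a b /=; rewrite mul0r addr0.
split=> //; have [muA muAE] : exists muA : {measure set T -> \bar R},
  forall B, muA B = mu1 (B `&` A) by exists (mrestr mu1 mA).
have mf : measurable_fun setT (fun x => (cabs (f x) ^+ 2)%:E).
  by apply/measurable_EFinP; exact: measurable_cabs_sqr.
have f0 x : (0 <= (cabs (f x) ^+ 2)%:E)%E by rewrite lee_fin sqr_ge0.
have -> : (\int[mu1]_x (cabs ((\1_A x : R)%:C%C * f x) ^+ 2)%:E =
    \int[mu1]_(x in A) (cabs (f x) ^+ 2)%:E)%E.
  rewrite [RHS]integral_mkcond; apply: eq_integral => x _.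
  by rewrite patchE indicE; case: ifPn => xA; rewrite ?mul1r ?mul0r ?cabs0 ?expr0n.
rewrite (@eq_measure_integral _ _ _ A muA); last first.
  by move=> B mB BA; rewrite muAE setIidl.
apply: (@le_lt_trans _ _ (\int[muA]_x (cabs (f x) ^+ 2)%:E)%E).
  by apply: ge0_subset_integral => //; exact: subsetT.
apply: le_lt_trans (@ge0_integral_le_mscale _ _ _ muA mu2 (NngNum c0) _ _ f0 mf) _.
  by move=> B mB /=; rewrite muAE; exact: mu12.
by rewrite lte_mul_pinfty// lee_fin.
Qed.

Lemma L2_comp mu (phi : T -> T) f : measurable_fun setT phi ->
  (forall B, measurable B -> mu (phi @^-1` B) = mu B) ->
  L2 mu f -> L2 mu (f \o phi).
Proof.
move=> mphi inv [mRe mIm f2]; split.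
- exact: (measurableT_comp mRe mphi).
- exact: (measurableT_comp mIm mphi).
have mf : measurable_fun setT (fun x => (cabs (f x) ^+ 2)%:E).
  by apply/measurable_EFinP; exact: measurable_cabs_sqr.
have := @ge0_integral_pushforward _ _ _ _ R phi mphi mu setT _ measurableT mf.
rewrite preimage_setT /comp/= => <-; last by move=> x _; rewrite lee_fin sqr_ge0.
rewrite (eq_measure_integral mu)// => B mB _; exact: inv.
Qed.

End square_integrable.

(** * Limits of matrices and of box averages *)

Section limits.
Context {R : realType}.

Lemma cvg_mx_entry n (u : nat -> 'M[R[i]^o]_n) (l : 'M[R[i]^o]_n) i j :
  u @ \oo --> l -> (u m i j : R[i]^o) @[m --> \oo] --> (l i j : R[i]^o).
Proof.
move=> /cvg_mx_entourageP ul; apply/cvg_entourageP => A entA.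
by apply: (@filterS _ \oo _ _ _ _ (ul A entA)) => m /(_ i j); rewrite inE.
Qed.

Lemma cvg_mx1 (u : nat -> 'M[R[i]^o]_1) (l : 'M[R[i]^o]_1) :
  (u m 0 0 : R[i]^o) @[m --> \oo] --> (l 0 0 : R[i]^o) -> u @ \oo --> l.
Proof.
move=> /cvg_entourageP ul; apply/cvg_mx_entourageP => A entA.
by apply: (@filterS _ \oo _ _ _ _ (ul A entA)) => m um i j; rewrite /= inE !ord1.
Qed.

Lemma cvg_real_complex (u : nat -> R) (l : R) :
  u @ \oo --> l -> ((u m)%:C%C : R[i]^o) @[m --> \oo] --> (l%:C%C : R[i]^o).
Proof.
move=> /cvgrPdist_lt ul; apply/cvgrPdist_lt => e e0.
have eE : e = (complex.Re e)%:C%C by rewrite (RRe_real (gtr0_real e0)).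
have e0' : 0 < complex.Re e by rewrite -ltcR -eE.
apply: (@filterS _ \oo _ _ _ _ (ul _ e0')) => m um.
by rewrite -rmorphB/= normc_def/= expr0n addr0 sqrtr_sqr eE ltcR.
Qed.

(* Boxes [0, m 1] have (m + 1) ^ r points but are normalized by m ^ r. *)
Lemma cvg_box_ratio r :
  (((m ^ r)%:R^-1 : R[i]) * (m.+1 ^ r)%:R : R[i]^o) @[m --> \oo] --> (1 : R[i]^o).
Proof.
have -> : (fun m => ((m ^ r)%:R^-1 : R[i]) * (m.+1 ^ r)%:R) =
    (fun m => ((m%:R^-1 * m.+1%:R) ^+ r : R)%:C%C).
  apply/funext => m.
  rewrite [RHS]rmorphXn/= [in RHS]rmorphM/= fmorphV/=.
by rewrite !rmorph_nat exprMn exprVn -!natrX.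
apply: (@cvg_real_complex _ 1).
have h1 : (m%:R^-1 * m.+1%:R : R) @[m --> \oo] --> (1 : R).
  (* This is the sequence (m + 1) / m shifted by one index; the shift drops m = 0, where the inverse
     is 0 by convention. *)
  have : (fun m => 1 + harmonic m) @ \oo --> (1 : R).
    by rewrite -[X in _ --> X]addr0; apply: cvgD; [exact: cvg_cst|exact: cvg_harmonic].
  rewrite (_ : (fun m => 1 + _) = fun m => m.+1%:R^-1 * m.+2%:R); last first.
    by apply/funext => m; rewrite /= -[m.+2%:R]natr1 mulrDr mulVf ?pnatr_eq0// mulr1.
  by rewrite (cvg_shiftS (fun m => m%:R^-1 * m.+1%:R : R)).
elim: r => [|r ih]; first by under eq_fun do rewrite expr0; exact: cvg_cst.
under eq_fun do rewrite exprS.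
by have := cvgM h1 ih; rewrite mulr1 => /(_ _); exact.
Qed.

Lemma cvg_mulr_cancel (u : nat -> R[i]) (l z : R[i]) : z != 0 ->
  (u m * z : R[i]^o) @[m --> \oo] --> (l * z : R[i]^o) ->
  (u m : R[i]^o) @[m --> \oo] --> (l : R[i]^o).
Proof.
move=> z0 uz.
have uE : u = (fun m => u m * z * z^-1) by apply/funext => m; rewrite mulfK.
have lE : l = l * z * z^-1 by rewrite mulfK.
by rewrite uE lE; apply: cvgM; [exact: uz|exact: cvg_cst].
Qed.

End limits.

(** * Invariant sets and multiplicativity of [W] *)

Section dynamics.
Context {d} {T : measurableType d} {R : realType} {r n : nat}.
Implicit Types (S : 'rV[int]_r -> T -> T) (W : 'M[cmeasure T R]_n).

(** Invariance is exact, not up to null sets, so the indicator of [A] is literally fixed by every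
    translation. *)
Definition invariant_set S (A : set T) :=
  measurable A /\ forall k, S k @^-1` A = A.

Lemma invariant_setT S : invariant_set S setT.
Proof. by split. Qed.

Lemma invariant_setI S A B :
  invariant_set S A -> invariant_set S B -> invariant_set S (A `&` B).
Proof.
move=> [mA SA] [mB SB]; split; first exact: measurableI.
by move=> k; rewrite preimage_setI SA SB.
Qed.

Lemma invariant_setD S A B :
  invariant_set S A -> invariant_set S B -> invariant_set S (A `\` B).
Proof.
move=> [mA SA] [mB SB]; split; first exact: measurableD.
by move=> k; rewrite -[in RHS](SA k) -[in RHS](SB k).
Qed.

Lemma mxtvar_fin W : (mxtvar W setT < +oo)%E.
Proof.
by apply: lte_sum_pinfty => i _; apply: lte_sum_pinfty => j _; exact: tvar_fin.
Qed.

(** Every term of the ergodic mean of the indicators of [A] and [B] equals W(A & B), so the mean is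
    W(A & B) times a ratio tending to 1, while ergodicity gives the limit W(A) W(B). *)
Lemma mxmeas_invariantI W S A B : mxergodic W S -> invariant_set S A ->
  measurable B -> mxmeas W (A `&` B) = mxmeas W A *m mxmeas W B.
Proof.
move=> [_ erg] [mA SA] mB.
have := erg (fun x => (\1_A x : R)%:C%C) (fun x => (\1_B x : R)%:C%C)
  (L2_indic mA (mxtvar_fin W)) (L2_indic mB (mxtvar_fin W)).
have intE C : measurable C -> mxintegral W (fun x => (\1_C x : R)%:C%C) = mxmeas W C.
  by move=> mC; apply/matrixP => i j; rewrite !mxE cintegral_indic.
rewrite !intE//.
have meanE m : ergodic_mean W S (fun x => (\1_A x : R)%:C%C)
    (fun x => (\1_B x : R)%:C%C) m =
    (((m ^ r)%:R^-1 : R[i]) * (m.+1 ^ r)%:R) *: mxmeas W (A `&` B).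
  rewrite /ergodic_mean -scalerA; congr (_ *: _).
  rewrite -intE; last exact: measurableI.
  under eq_bigr => k _.
    rewrite (_ : (fun x => _) = fun x => (\1_(A `&` B) x : R)%:C%C); first over.
    apply/funext => x; rewrite -rmorphM/= indicI; congr (_ * _)%:C%C.
    by rewrite -[in RHS](SA (- box_point k)).
  by rewrite sumr_const card_mx card_ord mul1n scaler_nat.
move=> lim; apply/matrixP => i j.
have lim1 := @cvg_mx_entry _ _ _ _ i j lim.
have {}lim1 : (((m ^ r)%:R^-1 * (m.+1 ^ r)%:R) * W i j (A `&` B) : R[i]^o)
    @[m --> \oo] --> ((mxmeas W A *m mxmeas W B) i j : R[i]^o).
  have -> // : (fun m => ((m ^ r)%:R^-1 * (m.+1 ^ r)%:R) * W i j (A `&` B)) =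
      (fun m => ergodic_mean W S (fun x => (\1_A x : R)%:C%C)
        (fun x => (\1_B x : R)%:C%C) m i j).
  by apply/funext => m; rewrite meanE !mxE.
have lim2 : (((m ^ r)%:R^-1 * (m.+1 ^ r)%:R) * W i j (A `&` B) : R[i]^o)
    @[m --> \oo] --> (1 * W i j (A `&` B) : R[i]^o).
  by apply: cvgM; [exact: cvg_box_ratio|exact: cvg_cst].
rewrite mul1r in lim2; rewrite mxE.
exact: (cvg_unique (@norm_hausdorff _ _) lim2 lim1).
Qed.

End dynamics.

(** * Invariant Hahn decompositions *)

Section invariant_charges.
Context {d} {T : measurableType d} {R : realType} {r : nat}.
Context (S : 'rV[int]_r -> T -> T).
Context (S0 : forall x, S 0 x = x) (SD : forall k l x, S (k + l) x = S k (S l x)).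
Context (mS : forall k, measurable_fun setT (S k)).

Lemma measurable_preimage_action k B : measurable B -> measurable (S k @^-1` B).
Proof. by move=> mB; rewrite -[X in measurable X]setTI; exact: mS. Qed.

Lemma invariant_saturation N : measurable N ->
  invariant_set S (\bigcup_k S k @^-1` N).
Proof.
move=> mN; split.
  by apply: countable_bigcupT_measurable => // k; exact: measurable_preimage_action.
move=> k; apply/seteqP; split=> x [l _ /= Nl].
  by exists (l + k); rewrite //= SD.
by exists (l - k); rewrite //= -SD subrK.
Qed.

(** Invariance of [nu] makes every translate of [N] negative, and a countable union of negative sets
    is negative. *)
Lemma negative_saturation (nu : {charge set T -> \bar R}) N :
  (forall k B, measurable B -> nu (S k @^-1` B) = nu B) ->
  negative_set nu N -> negative_set nu (\bigcup_k S k @^-1` N).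
Proof.
move=> nuS [mN negN].
(* The translates are enumerated through a coding of the group by naturals; numbers that code
   nothing get the empty set. *)
pose F n := if @choice.unpickle ('rV[int]_r) n is Some k then S k @^-1` N else set0.
have -> : \bigcup_k S k @^-1` N = \bigcup_n F n.
  apply/seteqP; split=> x [].
    by move=> k _ Nk; exists (choice.pickle k) => //; rewrite /F choice.pickleK.
  by move=> n _; rewrite /F; case: (choice.unpickle n) => // k Nk; exists k.
apply: bigcup_negative_set => n; rewrite /F.
case: (choice.unpickle n) => [k|]; last exact: negative_set0.
split=> [|B mB BN]; first exact: measurable_preimage_action.
rewrite -(nuS (- k))//; apply: negN => [|x /= /BN /=].
  exact: measurable_preimage_action.
by rewrite -SD subrr S0.
Qed.

(* Saturating the negative part of a Hahn decomposition makes it invariant. *)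
Lemma invariant_charge_eq0 (nu : {charge set T -> \bar R}) A : measurable A ->
  (forall k B, measurable B -> nu (S k @^-1` B) = nu B) ->
  (forall P, invariant_set S P ->
    (forall C, measurable C -> nu (C `&` (P `&` A)) = 0%E) \/
    (forall C, measurable C -> nu (C `&` (A `\` P)) = 0%E)) ->
  nu A = 0%E -> forall B, measurable B -> nu (B `&` A) = 0%E.
Proof.
move=> mA nuS nuA nuA0.
have [P [N [[mP posP] [mN negN] PNT _]]] := Hahn_decomposition nu.
have [mN' negN'] := negative_saturation nuS (conj mN negN).
have invN' := invariant_saturation mN.
set N' := \bigcup_k _ in mN' negN' invN'.
(* The saturation contains [N], as its translate by 0, so its complement lies in [P]. *)
have posN' C : measurable C -> (0 <= nu (C `\` N'))%E.
  move=> mC; apply: posP; first exact: measurableD.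
  move=> x [_ N'x]; have : (P `|` N) x by rewrite PNT.
  by case=> // Nx; case: N'x; exists 0; rewrite //= S0.
have negI C : measurable C -> (nu (C `&` N') <= 0)%E.
  by move=> mC; apply: negN'; [exact: measurableI|exact: subIsetr].
have splitA C : measurable C -> (nu (C `&` A) + nu ((A `\` C) `&` A) = 0)%E.
  move=> mC; rewrite -nuA0 [RHS](chargeDI nu mA mC) addeC; congr (_ + nu _)%E.
  - by congr (nu _); apply/seteqP; split=> x []//; case.
  - by rewrite setIC.
move=> B mB.
have splitN C : measurable C ->
    (nu (C `&` A) = nu (C `&` A `&` N') + nu ((C `&` A) `\` N'))%E.
  by move=> mC; rewrite [LHS](chargeDI nu (measurableI _ _ mC mA) mN') addeC.
have mAB : measurable (A `\` B) by exact: measurableD.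
(* Whichever of the two pieces of [A] is null, [nu] has constant sign on [A]. The values on [B] and
   on its complement within [A] then have the same sign and sum to 0, so both vanish. *)
case: (nuA _ invN') => nu0.
  have pos C : measurable C -> (0 <= nu (C `&` A))%E.
    move=> mC; rewrite splitN// -setIA [A `&` _]setIC nu0// add0e.
    by apply: posN'; exact: measurableI.
  have := splitA _ mB; have := pos _ mB; have := pos _ mAB.
  by move=> p1 p2 /eqP; rewrite padde_eq0// => /andP[/eqP].
have neg C : measurable C -> (nu (C `&` A) <= 0)%E.
  move=> mC; rewrite splitN// -setIDA nu0// adde0.
  by apply: negI; exact: measurableI.
have := splitA _ mB; have := neg _ mB; have := neg _ mAB.
by move=> p1 p2 /eqP; rewrite nadde_eq0// => /andP[/eqP].
Qed.

End invariant_charges.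

(** * Irreducible invariant sets *)

Section irreducible_sets.
Context {d} {T : measurableType d} {R : realType} {r n : nat}.
Context (S : 'rV[int]_r -> T -> T) (W : 'M[cmeasure T R]_n).

Lemma cmeasID (w : cmeasure T R) A B : measurable A -> measurable B ->
  w A = w (A `&` B) + w (A `\` B).
Proof.
move=> mA mB; have := chargeDI (cRe w) mA mB; have := chargeDI (cIm w) mA mB.
rewrite /= /cRe /cIm -!EFinD => -[eIm] [eRe].
by apply/eqP; rewrite eq_complex !raddfD/= eIm eRe addrC eqxx addrC eqxx.
Qed.

Lemma mxmeasID A B : measurable A -> measurable B ->
  mxmeas W A = mxmeas W (A `&` B) + mxmeas W (A `\` B).
Proof. by move=> mA mB; apply/matrixP => i j; rewrite !mxE -cmeasID. Qed.

Lemma mxmeas0 : mxmeas W set0 = 0.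
Proof.
apply/matrixP => i j; rewrite !mxE.
by rewrite (csigma_additive0 (@cmeas_sigma_additive _ _ _ (W i j))).
Qed.

(** For ergodic [W], an invariant set of measure 0 has only measurable subsets of measure 0, by
    multiplicativity, so vanishing of one matrix expresses nullity. Null sets count as
    irreducible. *)
Definition irreducible_set A := invariant_set S A /\
  forall P, invariant_set S P -> mxmeas W (P `&` A) = 0 \/ mxmeas W (A `\` P) = 0.

Context (erg : mxergodic W S).

(** As W(B) = W(B) W(A), the row space of W(B) lies in that of W(A). Equality would give W(A) = X
    W(B), whence W(A \ B) = W(A) W(A \ B) = X W(B) W(A \ B) = 0. *)
Lemma mxrank_invariant_lt A B : invariant_set S A -> invariant_set S B ->
  B `<=` A -> mxmeas W (A `\` B) != 0 -> (\rank (mxmeas W B) < \rank (mxmeas W A))%N.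
Proof.
move=> iA iB BA nz; have [mA _] := iA; have [mB _] := iB.
have iD := invariant_setD iA iB; have [mD _] := iD.
have BE : mxmeas W B = mxmeas W B *m mxmeas W A.
  by rewrite -(mxmeas_invariantI erg)// setIidl.
have BleA : (mxmeas W B <= mxmeas W A)%MS by rewrite BE submxMl.
rewrite ltn_neqAle (mxrankS BleA) andbT; apply: contra nz.
rewrite (eq_leqif (mxrank_leqif_sup BleA)) => /submxP[X AX].
have -> : A `\` B = A `&` (A `\` B) by rewrite setIidr//; exact: subDsetl.
rewrite (mxmeas_invariantI erg)// AX -mulmxA -(mxmeas_invariantI erg)//.
by rewrite setIDA setIC -setIDA setDv setI0 mxmeas0 mulmx0.
Qed.

(** Induction on the rank of W(A): a reducible set splits into two invariant pieces, both of smaller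
    rank since neither is null. *)
Lemma irreducible_decomposition A : invariant_set S A ->
  exists s : seq (set T), (forall C, C \in s -> irreducible_set C) /\
    forall B, measurable B -> mxmeas W (B `&` A) = \sum_(C <- s) mxmeas W (B `&` C).
Proof.
have [m] := ubnP (\rank (mxmeas W A)); elim: m A => // m IH A.
rewrite ltnS => rkA iA; have [mA _] := iA.
have [irrA|] := pselect (irreducible_set A).
  exists [:: A]; split=> [C|B mB]; first by rewrite mem_seq1 => /eqP ->.
  by rewrite big_seq1.
move=> /not_andP[//|/existsNP[P /not_implyP[iP /not_orP[/eqP nz1 /eqP nz2]]]].
have [mP _] := iP; have i1 := invariant_setI iP iA; have i2 := invariant_setD iA iP.
have [|s1 [irr1 sum1]] := IH _ _ i1.
  apply: leq_trans rkA; apply: mxrank_invariant_lt => //.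
  by rewrite setDIr setDv setU0.
have [|s2 [irr2 sum2]] := IH _ _ i2.
  apply: leq_trans rkA; apply: mxrank_invariant_lt => //.
  by rewrite setDD setIC.
exists (s1 ++ s2); split=> [C|B mB].
  by rewrite mem_cat => /orP[/irr1|/irr2].
rewrite big_cat/= -sum1// -sum2// (mxmeasID (measurableI _ _ mB mA) mP).
by rewrite -setIA [A `&` P]setIC setIDA.
Qed.

Context (S0 : forall x, S 0 x = x) (SD : forall k l x, S (k + l) x = S k (S l x)).
Context (mS : forall k, measurable_fun setT (S k)).

Let csigma_additive_comb (z c : R[i]) (w1 w2 : cmeasure T R) :
  csigma_additive (fun B => z * w1 B + c * w2 B).
Proof.
move=> F mF tF; under eq_fun do rewrite big_split/= -!mulr_sumr.
apply: cvgD; apply: cvgM; try exact: cvg_cst; exact: cmeas_sigma_additive.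
Qed.

(* On an irreducible set A, the signed measure [Re (l o W)] vanishes as soon as
   it vanishes at A, for every linear form l; so W takes values in the real line
   spanned by W(A). *)
Lemma irreducible_density A : irreducible_set A ->
  exists lam : set T -> R, forall B, measurable B ->
    mxmeas W (B `&` A) = (lam B)%:C%C *: mxmeas W A.
Proof.
move=> [iA irrA]; have [mA _] := iA.
have [/existsP[k /existsP[l nz]]|z0] :=
    boolP [exists k, exists l, W k l A != 0]; last first.
  exists (fun=> 0) => B mB; rewrite scale0r setIC (mxmeas_invariantI erg)//.
  rewrite [mxmeas W A](_ : _ = 0) ?mul0mx//; apply/matrixP => k l; rewrite !mxE.
  by apply/eqP; apply: contraNT z0 => kl; apply/existsP; exists k; apply/existsP; exists l.
(* The ratio is taken at a nonzero entry of W(A). Only its real part is kept; the equality proved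
   below at the entry (k, l) shows that the ratio is real. *)
pose lam B := complex.Re (W k l (B `&` A) / W k l A).
exists lam => B mB; apply/matrixP => i j; rewrite !mxE.
have key z : complex.Re (z * W i j (B `&` A)) =
    complex.Re (z * ((lam B)%:C%C * W i j A)).
  (* The coefficient [c] is chosen so that the real part of z W_ij + c W_kl vanishes at [A]. *)
  pose a := complex.Re (z * W i j A); pose c : R[i] := - (a%:C%C / W k l A).
  pose w := CMeasure (@csigma_additive_comb z c (W i j) (W k l)).
  have wE C : cRe w C = (complex.Re (z * W i j C + c * W k l C))%:E by [].
  have : cRe w (B `&` A) = 0%E.
    apply: (invariant_charge_eq0 S0 SD mS) => //.
    - by move=> q C mC; have [inv _] := erg; rewrite [LHS]wE [RHS]wE !inv.
    - move=> P iP; case: (irrA P iP) => W0; [left|right] => C mC.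
      + have iPA := invariant_setI iP iA; have [mPA _] := iPA.
        have : mxmeas W (C `&` (P `&` A)) = 0.
          by rewrite setIC (mxmeas_invariantI erg)// W0 mul0mx.
        move=> /matrixP W0'; have := W0' i j; have := W0' k l; rewrite !mxE => e1 e2.
        by rewrite [LHS]wE e1 e2 !mulr0 addr0.
      + have iPA := invariant_setD iA iP; have [mPA _] := iPA.
        have : mxmeas W (C `&` (A `\` P)) = 0.
          by rewrite setIC (mxmeas_invariantI erg)// W0 mul0mx.
        move=> /matrixP W0'; have := W0' i j; have := W0' k l; rewrite !mxE => e1 e2.
        by rewrite [LHS]wE e1 e2 !mulr0 addr0.
    - by rewrite [LHS]wE /c mulNr divfK// raddfB/= -/a subrr.
  rewrite wE /c mulNr => -[] /eqP; rewrite raddfB/= subr_eq0 => /eqP ->.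
  rewrite -mulrA [(W k l A)^-1 * _]mulrC [RHS](congr1 _ (mulrCA _ _ _)) /lam /a.
  move: (W k l (B `&` A) / W k l A) (z * W i j A) => [x y] [u v] /=.
  by rewrite !mul0r !subr0 mulrC.
(* The multipliers 1 and i recover the real and the imaginary part. *)
have := key 1; have := key 'i%C.
move: (W i j (B `&` A)) ((lam B)%:C%C * W i j A) => [x y] [u v] /=.
by rewrite !mul0r !mul1r !sub0r !subr0 => /oppr_inj -> ->.
Qed.

End irreducible_sets.

(** * Ergodicity of the components *)

Section ergodic_components.
Context {d} {T : measurableType d} {R : realType} {r n : nat}.
Context (S : 'rV[int]_r -> T -> T) (W : 'M[cmeasure T R]_n).

Lemma eq_L2 (mu1 mu2 : {measure set T -> \bar R}) (f : T -> R[i]) :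
  (forall B, measurable B -> mu1 B = mu2 B) -> L2 mu1 f -> L2 mu2 f.
Proof.
move=> mu12 [mRe mIm f2]; split=> //.
by rewrite (eq_measure_integral mu1)// => B mB _; rewrite mu12.
Qed.

(* If W restricted to A is [w] times the matrix W(A), the ergodic means of w for
   f and g are read off those of W for [f 1_A] and [g 1_A] at a nonzero entry
   of W(A). *)
Lemma ergodic_component (w : cmeasure T R) A :
  (forall x, S 0 x = x) -> (forall k l x, S (k + l) x = S k (S l x)) ->
  (forall k, measurable_fun setT (S k)) ->
  mxergodic W S -> invariant_set S A -> mxmeas W A != 0 ->
  (forall B, measurable B -> mxmeas W (B `&` A) = w B *: mxmeas W A) ->
  (forall B, measurable B -> complex.Im (w B) = 0) ->
  invariant_measure w S -> ergodic_measure w S.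
Proof.
move=> S0 SD mS erg iA nzA wE wreal winv.
split=> [i j|f g f2 g2]; first by rewrite mxE.
have [mA SA] := iA.
(* Invariance of |w| keeps the translates of [f] in L2. The inequality for [- k], applied to the
   translated set, gives the reverse one. *)
have tvarS k B : measurable B -> tvar w (S k @^-1` B) = tvar w B.
  move=> mB; have le l C : (tvar w (S l @^-1` C) <= tvar w C)%E.
    apply: (@tvar_preimage_le _ _ _ _ _ (S (- l))) => //.
      by move=> x; rewrite -SD subrr S0.
    by move=> D mD; exact: winv.
  apply/eqP; rewrite eq_le le/=.
  apply: le_trans (le (- k) _); rewrite (_ : _ @^-1` _ = B)//.
  by apply/seteqP; split=> x /=; rewrite -SD subrr S0.
have toL2 h : L2 (mxtvar (const_mx w : 'M[cmeasure T R]_1)) h -> L2 (tvar w) h.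
  apply: eq_L2 => B mB.
  by transitivity (\sum_(i < 1) \sum_(j < 1) tvar ((const_mx w : 'M[cmeasure T R]_1) i j) B)%E;
    rewrite // !big_ord1 mxE.
have {}f2 := toL2 _ f2; have {}g2 := toL2 _ g2.
have wAE i j B : measurable B -> W i j (B `&` A) = W i j A * w B.
  move=> /wE /matrixP /(_ i j); rewrite !mxE => ->.
  by rewrite mulrC.
(* On [A], each |W_ij| is at most |W_ij(A)| |w|, so |W| is at most c |w| there. *)
pose c := \sum_i \sum_j cabs (W i j A).
have c0 : 0 <= c by apply: sumr_ge0 => i _; apply: sumr_ge0 => j _; exact: cabs_ge0.
have L2W h : L2 (tvar w) h -> L2 (mxtvar W) (fun x => (\1_A x : R)%:C%C * h x).
  apply: (L2_restr mA c0) => B mB.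
  rewrite /c -sumEFin ge0_sume_distrl; last first.
    by move=> i _; rewrite lee_fin; apply: sumr_ge0 => j _; exact: cabs_ge0.
  apply: lee_sum => i _; rewrite -sumEFin ge0_sume_distrl; last first.
    by move=> j _; rewrite lee_fin cabs_ge0.
  by apply: lee_sum => j _; apply: tvar_restr_le => C mC; exact: wAE.
have intE h : (tvar w).-integrable setT (fun x => (complex.Re (h x))%:E) ->
    (tvar w).-integrable setT (fun x => (complex.Im (h x))%:E) ->
    mxintegral W (fun x => (\1_A x : R)%:C%C * h x) = cintegral w h *: mxmeas W A.
  move=> iRe iIm; apply/matrixP => i j; rewrite !mxE mulrC.
  by apply: cintegral_restr => // B mB; exact: wAE.
have intL2 h : L2 (tvar w) h ->
    mxintegral W (fun x => (\1_A x : R)%:C%C * h x) = cintegral w h *: mxmeas W A.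
  (* Writing [h] as 1 times [h] yields its integrability, since |w| is finite and 1 is therefore in
     L2. *)
  move=> h2; have h1 : (fun x => (\1_setT x : R)%:C%C * h x) = h.
    by apply/funext => x; rewrite indicT mul1r.
  suff [iRe iIm] : (tvar w).-integrable setT (fun x => (complex.Re (h x))%:E) /\
      (tvar w).-integrable setT (fun x => (complex.Im (h x))%:E) by exact: intE.
  by rewrite -h1; exact: L2_mul_integrable (L2_indic measurableT (tvar_fin w)) h2.
have [_ /(_ _ _ (L2W _ f2) (L2W _ g2)) lim] := erg.
(* Idempotence turns the limit, a product of two multiples of W(A), back into a multiple of W(A). *)
have idE : mxmeas W A *m mxmeas W A = mxmeas W A.
  by rewrite -(mxmeas_invariantI erg)// setIid.
pose u m := ergodic_mean (const_mx w : 'M[cmeasure T R]_1) S f g m 0 0.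
have meanE m : ergodic_mean W S (fun x => (\1_A x : R)%:C%C * f x)
    (fun x => (\1_A x : R)%:C%C * g x) m = u m *: mxmeas W A.
  rewrite /u /ergodic_mean mxE summxE -scalerA scaler_suml; congr (_ *: _).
  apply: eq_bigr => k _; rewrite mxE mxE.
  have [iRe iIm] := L2_mul_integrable (L2_comp (mS (- box_point k))
    (tvarS (- box_point k)) f2) g2.
  rewrite -(intE _ iRe iIm); congr mxintegral; apply/funext => x /=.
  (* By invariance of [A], the translated and the original indicator agree, and their product is the
     indicator itself. *)
  rewrite mulrACA -rmorphM/=; congr (_%:C%C * _).
  rewrite (_ : \1_A (S _ x) = \1_A x) ?indicE; last by rewrite -[in RHS](SA (- box_point k)).
  by case: (x \in A); rewrite ?mulr1 ?mulr0.
have [k [l nz]] : exists k l, W k l A != 0.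
  apply: contrapT => z; move/negP: nzA; apply; apply/eqP/matrixP => k l; rewrite !mxE.
  by apply: contrapT => /eqP nz; apply: z; exists k, l.
have := @cvg_mx_entry _ _ _ _ k l lim.
have -> : (fun m => ergodic_mean W S (fun x => (\1_A x : R)%:C%C * f x)
    (fun x => (\1_A x : R)%:C%C * g x) m k l) = (fun m => u m * W k l A).
  by apply/funext => m; rewrite meanE !mxE.
rewrite (intL2 _ f2) (intL2 _ g2) -scalemxAl -scalemxAr idE scalerA mxE [mxmeas _ _ _ _]mxE.
move=> limu; apply: cvg_mx1; rewrite [X in _ --> X]mxE big_ord1 !mxE.
exact: cvg_mulr_cancel nz limu.
Qed.

End ergodic_components.

(** The minimal polynomial divides X (X - 1), which has distinct roots. *)
Lemma idempotent_diagonalizable (F : fieldType) n (A : 'M[F]_n) :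
  A *m A = A -> exists2 P, P \in unitmx & is_diag_mx (mxpoly.conjmx P A).
Proof.
case: n A => [|n] A AA.
  by exists 1%:M; [exact: unitmx1|apply/is_diag_mxP => -[]].
apply/mxpoly.diagonalizableP; exists [:: 0; 1].
  by rewrite /= inE eq_sym oner_eq0.
apply: mxminpoly_min; rewrite big_cons big_seq1 subr0 rmorphM rmorphB/=.
by rewrite horner_mx_X horner_mx_C mulrBr mulr1 [A * A]AA subrr.
Qed.

(** * Simultaneous diagonalization *)

Section diagonalization.
Context {d} {T : measurableType d} {R : realType} {r n : nat}.
Context (S : 'rV[int]_r -> T -> T) (W : 'M[cmeasure T R]_n).

(** Nondegeneracy enters here: W(B) = W(X) W(B), and an invertible W(B) cancels. *)
Lemma mxmeas_setT : mxergodic W S -> mxnondegenerate W -> mxmeas W setT = 1%:M.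
Proof.
move=> erg [B mB uB].
have := mxmeas_invariantI erg (invariant_setT S) mB.
by rewrite setTI => /(congr1 (mulmxr (invmx (mxmeas W B)))); rewrite /= mulmxK// mulmxV.
Qed.

Lemma ergodic_diagonalization :
  (forall x, S 0 x = x) -> (forall k l x, S (k + l) x = S k (S l x)) ->
  (forall k, measurable_fun setT (S k)) ->
  mxnondegenerate W -> mxergodic W S ->
  exists Q : 'M[R[i]]_n,
    [/\ Q \in unitmx, diagonal_mxmeas (mxconj Q W) &
        forall i, ergodic_measure (mxconj Q W i i) S].
Proof.
move=> S0 SD mS nd erg.
have [s [irr sumW]] := irreducible_decomposition erg (invariant_setT S).
have inv C : C \in s -> invariant_set S C by move=> /irr[].
have meas C : C \in s -> measurable C by move=> /inv[].
have [Q uQ diagQ] : exists2 Q : 'M[R[i]]_n, Q \in unitmx &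
    forall C, C \in s -> forall i j, i != j -> (Q *m mxmeas W C *m invmx Q) i j = 0.
  have [|Q uQ /allP diagQ] := (mxpoly.codiagonalizableP [seq mxmeas W C | C <- s]).1.
    (* Through multiplicativity, commutation is the symmetry of intersection, and idempotence is C &
       C = C. *)
    split=> [A B /mapP[C Cs ->] /mapP[D Ds ->]|A /mapP[C Cs ->]].
      rewrite /comm_mx -(mxmeas_invariantI erg (inv _ Cs) (meas _ Ds)) setIC.
      exact: mxmeas_invariantI erg (inv _ Ds) (meas _ Cs).
    apply: idempotent_diagonalizable.
    by rewrite -(mxmeas_invariantI erg (inv _ Cs) (meas _ Cs)) setIid.
  exists Q => // C Cs i j ij.
  have := diagQ _ (map_f _ Cs).
  by move=> /(diagonalizable_forP _ uQ); apply.
exists Q; pose D B := Q *m mxmeas W B *m invmx Q.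
have DE i j B : mxconj Q W i j B = D B i j.
  by rewrite /D -mxmeas_mxconj [RHS]mxE.
have DI C B : invariant_set S C -> measurable B -> D (C `&` B) = D C *m D B.
  move=> iC mB; rewrite /D (mxmeas_invariantI erg)//.
  by rewrite !mulmxA mulmxKV.
have Dsum B : measurable B -> D B = \sum_(C <- s) D (B `&` C).
  by move=> mB; rewrite /D -[in LHS](setIT B) sumW// mulmx_sumr mulmx_suml.
have lamE C : C \in s -> exists lam : set T -> R, forall B, measurable B ->
    mxmeas W (B `&` C) = (lam B)%:C%C *: mxmeas W C.
  by move=> /irr irrC; exact: irreducible_density erg S0 SD mS _ irrC.
split=> // [i j ij B mB|p].
  rewrite DE Dsum// summxE big1_seq// => C /andP[_ Cs].
  have [lam lamC] := lamE _ Cs.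
  by rewrite /D lamC// -scalemxAr -scalemxAl mxE diagQ// mulr0.
(* The p-th diagonal entries of the D(C) sum to that of D(X) = 1, so one is nonzero; being
   idempotent, it equals 1. *)
have [C Cs nz] : exists2 C, C \in s & D C p p != 0.
  apply: contrapT => z.
  have : D setT p p = 1 by rewrite /D mxmeas_setT// mulmx1 mulmxV// mxE eqxx.
  rewrite Dsum// summxE big1_seq => [/esym/eqP|C /andP[_ Cs]]; first by rewrite oner_eq0.
  by rewrite setTI; apply: contrapT => /eqP nz; apply: z; exists C.
have DCp M : (D C *m M) p p = D C p p * M p p.
  rewrite mxE (bigD1 p)//= big1 ?addr0// => j jp.
  by rewrite [D C p j]diagQ ?mul0r// eq_sym.
have D1 : D C p p = 1.
  apply: (mulfI nz); rewrite mulr1 -DCp -DI ?setIid; [by []|exact: inv|exact: meas].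
have [lam lamC] := lamE _ Cs.
(* Because D(C) has p-th diagonal entry 1, the p-th eigenmeasure gives [B] and B & C the same value,
   namely the real number [lam B]. *)
have wE B : measurable B -> mxconj Q W p p B = (lam B)%:C%C.
  move=> mB; rewrite DE -[LHS]mul1r -D1 -DCp -DI//; last exact: inv.
  by rewrite setIC /D lamC// -scalemxAr -scalemxAl mxE [X in _ * X]D1 mulr1.
apply: (ergodic_component S0 SD mS erg (inv _ Cs)) => [|B mB|B mB|k B mB].
- by apply: contra nz => /eqP W0; rewrite /D W0 mulmx0 mul0mx mxE.
- by rewrite lamC// wE.
- by rewrite wE.
- rewrite !DE /D; congr ((_ *m _ *m _) _ _).
  by apply/matrixP => i j; rewrite !mxE erg.1.
Qed.

End diagonalization.

(** * Continuous actions on compact metrizable spaces *)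

Theorem theorem5p9 (R : realType) (r n : nat) (X : ptopologicalType)
    (S : 'rV[int]_r -> X -> X) (W : 'M[cmeasure (borelType X) R]_n) :
  compact [set: X] -> metrizable R X -> continuous_Zd_action S ->
  (1 <= n)%N ->
  mxinvariant W S -> mxnondegenerate W -> mxergodic W S ->
  exists Q : 'M[R[i]]_n,
    [/\ Q \in unitmx, diagonal_mxmeas (mxconj Q W) &
        forall i, ergodic_measure (mxconj Q W i i) S].
Proof.
move=> _ _ [S0 SD cS] _ _ nd erg.
apply: ergodic_diagonalization => // k.
(* Open sets generate the Borel sets, so it suffices to look at their preimages. *)
apply: (@measurability _ _ (borelType X) (borelType X) setT (S k) (@open X) erefl).
move=> _ [B oB <-].
rewrite setTI; apply: sub_sigma_algebra.
by move/continuousP : (cS k); apply.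
Qed.
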